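(* Let $G$ be a decomposable bipartite graph. Then $\chi_{\mathrm{irr}}'(G) \le 7$. Moreover, if $G$ has an even number of edges, then $\chi_{\mathrm{irr}}'(G) \le 6$.
   Context: All graphs are finite and simple. A graph is locally irregular if for every vertex $v$ all neighbors of $v$ have degrees distinct from the degree of $v$ (equivalently, any two adjacent vertices have distinct degrees). A locally irregular edge-coloring of a graph $G$ is a (not necessarily proper) edge-coloring of $G$ such that, for every color, the subgraph induced on the edges of that color is locally irregular. A graph is decomposable if it admits a locally irregular edge-coloring. For a decomposable graph $G$, the locally irregular chromatic index $\chi_{\mathrm{irr}}'(G)$ is the smallest number of colors in a locally irregular edge-coloring of $G$. *)

(* Defs.v *)
From mathcomp Require Import all_boot.

Set Implicit Arguments.
Unset Strict Implicit.
Unset Printing Implicit Defensive.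

Record sgraph := SGraph {
  vertex : finType;
  adj : rel vertex;
  adj_sym : symmetric adj;
  adj_irrefl : irreflexive adj
}.

Definition edges (G : sgraph) : {set {set vertex G}} :=
  [set e | [exists x, exists y, adj x y && (e == [set x; y])]].

Definition edge (G : sgraph) := {e : {set vertex G} | e \in edges G}.

Definition degree (G : sgraph) (x : vertex G) : nat := #|[set y | adj x y]|.

Definition bipartite (G : sgraph) : Prop :=
  exists A : {set vertex G},
    forall x y : vertex G, adj x y -> (x \in A) != (y \in A).

Definition locally_irregular (G : sgraph) : bool :=
  [forall x : vertex G, forall y : vertex G,
     adj x y ==> (degree x != degree y)].

Section ColorClass.
Variables (G : sgraph) (k : nat) (c : {ffun edge G -> 'I_k}) (i : 'I_k).

Definition class_adj : rel (vertex G) :=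
  fun x y => [exists e : edge G, (val e == [set x; y]) && (c e == i)].

Lemma class_adj_sym : symmetric class_adj.
Proof. by move=> x y; rewrite /class_adj setUC. Qed.

Lemma class_adj_irrefl : irreflexive class_adj.
Proof.
move=> x; apply/negbTE/negP => /existsP[[e /= He] /andP[/eqP De _]].
move: He; rewrite inE De => /existsP[u /existsP[v /andP[uv /eqP E]]].
have /set1P ux : u \in [set x] by rewrite -[[set x]]setUid E set21.
have /set1P vx : v \in [set x] by rewrite -[[set x]]setUid E set22.
by move: uv; rewrite ux vx adj_irrefl.
Qed.

(* All vertices of G are kept: those meeting no edge of color i are isolated,
   which does not affect local irregularity. *)
Definition color_class : sgraph := SGraph class_adj_sym class_adj_irrefl.

End ColorClass.

Definition li_coloring (G : sgraph) (k : nat) (c : {ffun edge G -> 'I_k}) : bool :=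
  [forall i : 'I_k, locally_irregular (color_class c i)].

(* Not every one of the k colors has to be used; since edge G may be empty,
   an edgeless graph is colorable with k = 0. *)
Definition li_colorable (G : sgraph) (k : nat) : bool :=
  [exists c : {ffun edge G -> 'I_k}, li_coloring c].

Definition decomposable (G : sgraph) : Prop := exists k, li_colorable G k.

Definition chi_irr (G : sgraph) (Gdec : decomposable G) : nat := ex_minn Gdec.

(* Main.v *)
(* It suffices to use six colours on every component E, viewed as a bipartite
   relation between X and Y.  A bipartite graph with all degrees even on one side
   and odd or zero on the other is locally irregular.

   Forests: if all degrees on one side X of a forest are even, then two colours
   suffice.  Colour each vertex of X (with all its edges), so that every vertex
   on the other side sees each colour an odd number of times or not at all; this
   is done greedily from the root.  Some odd vertices x of X are also allowed: one
   edge at x gets one colour, the remaining (evenly many) edges the other one.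

   Graphs K with even degrees on X need four colours.  A parity subgraph J of
   a spanning tree makes K - J locally irregular, except perhaps at the root.  If
   the root has the wrong parity, do this in K - v instead, for a non-cut vertex v
   of Y; the edges at v are then given a new colour, which is completed by single
   forest edges where the odd vertices adjacent to v require it.

   If a vertex z has degree at least 3, all edges at z together with a parity
   subgraph of a spanning tree containing them form a two-colourable forest
   whose removal makes all degrees on the side of z even: 2 + 4 colours.  This
   works whatever the parity of the number of edges.  If no such z exists,
   decomposability makes the number of edges even, and the star at z is not
   needed. *)
Require Import Defs.
From mathcomp Require Import all_boot.

Set Implicit Arguments.
Unset Strict Implicit.
Unset Printing Implicit Defensive.

(** * Bipartite relations and their locally irregular decompositions *)

Section Bigraph.

Variables X Y : finType.
Implicit Types (E : X -> Y -> bool) (c : X -> Y -> nat).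

Definition degX E x := #|[pred y | E x y]|.
Definition degY E y := #|[pred x | E x y]|.

Definition irregular E := forall x y, E x y -> degX E x != degY E y.

Definition colour_class E c i x y := E x y && (c x y == i).

(** Only the values of [c] on edges of [E] matter. Classes of colours [i >= k] are empty, so [i] may
    range over all naturals. *)
Definition li_dec k E :=
  exists c, (forall x y, E x y -> c x y < k) /\
            forall i, irregular (colour_class E c i).

Lemma eq_degX E E' x : E x =1 E' x -> degX E x = degX E' x.
Proof. exact: eq_card. Qed.

Lemma eq_degY E E' y : E^~ y =1 E'^~ y -> degY E y = degY E' y.
Proof. exact: eq_card. Qed.

Lemma eq_irregular E E' : E =2 E' -> irregular E -> irregular E'.
Proof.
move=> eqE irrE x y; rewrite -eqE => /irrE.
by rewrite (eq_degX (eqE x)) (@eq_degY E E') // => z; apply: eqE.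
Qed.

Lemma li_dec_leq k k' E : k <= k' -> li_dec k E -> li_dec k' E.
Proof.
move=> le_k [c [ck irr]]; exists c; split=> // x y /ck lt_k.
exact: leq_trans lt_k le_k.
Qed.

Lemma li_dec1 E : irregular E -> li_dec 1 E.
Proof.
move=> irr; exists (fun _ _ => 0); split=> // i x y.
case/andP=> Exy /eqP i0; move: (irr x y Exy).
by congr (_ != _); apply: eq_card => z; rewrite !inE /colour_class i0 eqxx andbT.
Qed.

Lemma li_dec_empty E : (forall x y, ~~ E x y) -> li_dec 0 E.
Proof.
move=> E0; exists (fun _ _ => 0); split=> [x y|i x y]; first by rewrite (negPf (E0 x y)).
by rewrite /colour_class (negPf (E0 x y)).
Qed.

Lemma li_dec_add k1 k2 E E1 E2 :
    (forall x y, E x y = E1 x y || E2 x y) ->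
    (forall x y, E1 x y -> ~~ E2 x y) ->
  li_dec k1 E1 -> li_dec k2 E2 -> li_dec (k1 + k2) E.
Proof.
move=> EU dis [c1 [ck1 irr1]] [c2 [ck2 irr2]].
pose c x y := if E1 x y then c1 x y else k1 + c2 x y.
have cE i : colour_class E c i =2
    (if i < k1 then colour_class E1 c1 i else colour_class E2 c2 (i - k1)).
  move=> x y; rewrite /colour_class EU /c.
  case E1xy: (E1 x y) => /=; case: ltnP => [lt|le] /=; rewrite ?E1xy //=.
  - have lt := ck1 _ _ E1xy.
    by rewrite (negPf (dis _ _ E1xy)) ltn_eqF // (leq_trans lt).
  - by rewrite gtn_eqF ?andbF // (leq_trans lt) ?leq_addr.
  - by rewrite -{1}(subnKC le) eqn_add2l.
exists c; split=> [x y Exy|i].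
  move: Exy; rewrite EU /c; case: (boolP (E1 x y)) => [E1xy _|_ /= E2xy].
    exact: leq_trans (ck1 _ _ E1xy) (leq_addr _ _).
  by rewrite ltn_add2l ck2.
by apply: eq_irregular (fun x y => esym (cE i x y)) _; case: ifP.
Qed.

(** Edges with different labels share no vertex, so the same [k] colours serve every label without
    changing a degree inside a class. *)
Lemma li_dec_label (I : finType) (f : X -> I) (g : Y -> I) k E :
    (forall x y, E x y -> f x = g y) ->
    (forall i, li_dec k (fun x y => E x y && (f x == i))) ->
  li_dec k E.
Proof.
move=> fg /fin_all_exists[c cP].
exists (fun x y => c (f x) x y); split=> [x y Exy|i x y].
  by have [ck _] := cP (f x); apply: ck; rewrite Exy /=.
case/andP=> Exy /eqP ci; have [_ /(_ i x y)] := cP (f x).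
rewrite {1}/colour_class Exy eqxx ci eqxx => /(_ isT).
congr (_ != _); apply: eq_card => z; rewrite !inE /colour_class ?eqxx ?andbT //.
case Ezy: (E z y) => //=.
by rewrite (fg _ _ Ezy) (fg _ _ Exy) eqxx.
Qed.

Lemma li_dec_restrict (I : finType) (f : X -> I) (g : Y -> I) k E i :
    (forall x y, E x y -> f x = g y) ->
  li_dec k E -> li_dec k (fun x y => E x y && (f x == i)).
Proof.
move=> fg [c [ck irr]]; exists c; split=> [x y /andP[/ck//]|j x y].
case/andP=> /andP[Exy fx] cj; have := irr j x y; rewrite /colour_class Exy cj => /(_ isT).
congr (_ != _); apply: eq_card => z; rewrite !inE /colour_class ?fx ?andbT //.
case Ezy: (E z y) => //=.
by rewrite (fg _ _ Ezy) -(fg _ _ Exy) fx.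
Qed.

Lemma degX_add E E1 E2 x :
    (forall y, E x y = E1 x y || E2 x y) -> (forall y, E1 x y -> ~~ E2 x y) ->
  degX E x = degX E1 x + degX E2 x.
Proof.
move=> EU dis; rewrite /degX -cardUI.
rewrite [X in _ = _ + X]eq_card0 ?addn0 => [|y].
  by apply: eq_card => y; rewrite !inE.
by rewrite !inE; apply/negP => /andP[/dis/negP].
Qed.

Lemma degX_gt0 E x y : E x y -> 0 < degX E x.
Proof. by move=> Exy; apply/card_gt0P; exists y. Qed.

Lemma degY_gt0 E x y : E x y -> 0 < degY E y.
Proof. by move=> Exy; apply/card_gt0P; exists x. Qed.

Lemma degX_sum E x : degX E x = \sum_y E x y.
Proof. by rewrite /degX -sum1_card big_mkcond. Qed.

Lemma degY_sum E y : degY E y = \sum_x E x y.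
Proof. by rewrite /degY -sum1_card big_mkcond. Qed.

Lemma sum_deg E : \sum_x degX E x = \sum_y degY E y.
Proof.
under eq_bigr do rewrite degX_sum.
by rewrite exchange_big; apply: eq_bigr => y _; rewrite degY_sum.
Qed.

Lemma parity_irregular E :
    (forall x, ~~ odd (degX E x)) ->
    (forall y, 0 < degY E y -> odd (degY E y)) ->
  irregular E.
Proof.
move=> evX oddY x y Exy; apply/eqP => eqd; move: (evX x).
by rewrite eqd oddY // (degY_gt0 Exy).
Qed.

End Bigraph.

Section Transpose.
Variables X Y : finType.
Implicit Type E : X -> Y -> bool.

Lemma li_dec_tr k E : li_dec k (fun y x => E x y) -> li_dec k E.
Proof.
move=> [c [ck irr]]; exists (fun x y => c y x); split=> [x y /ck//|i x y H].
by rewrite eq_sym; apply: irr.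
Qed.

Lemma degY_add E E1 E2 y :
    (forall x, E x y = E1 x y || E2 x y) -> (forall x, E1 x y -> ~~ E2 x y) ->
  degY E y = degY E1 y + degY E2 y.
Proof. exact: (@degX_add Y X (fun y x => E x y) (fun y x => E1 x y) (fun y x => E2 x y)). Qed.

End Transpose.

(** * Parity counting, recursion along a rank, distances *)

Lemma odd_sum (I : finType) (P : pred I) (F : I -> nat) :
  odd (\sum_(i | P i) F i) = odd (\sum_(i | P i) odd (F i)).
Proof.
elim/big_rec2: _ => // i m n _; rewrite !oddD => ->.
by rewrite oddb.
Qed.

(** An even degree sum leaves an even number of odd vertices in [Y], so the parity at [r] is
    dictated by the others. *)
Lemma odd_root (X Y : finType) (E : X -> Y -> bool) (S : pred Y) r :
    ~~ odd (\sum_y degY E y) ->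
    (forall y, y != r -> odd (degY E y) = S y) ->
  odd (degY E r) = odd #|[pred y | (y != r) && S y]|.
Proof.
rewrite odd_sum (bigD1 r) //= oddD addbC => ev oddE.
have -> : #|[pred y | (y != r) && S y]| = \sum_(y | y != r) odd (degY E y).
  rewrite -sum1_card big_mkcondr; apply: eq_bigr => y yr.
  by rewrite oddE //; case: (S y).
by move: ev; rewrite oddb; case: (odd (degY E r)); case: (odd _).
Qed.

(** Only values of smaller rank enter [Phi], so iterating it makes the value at [x] stable after
    more than [m x] rounds. *)
Lemma rank_rec (V : finType) (R : Type) (m : V -> nat) (Phi : (V -> R) -> V -> R) (a : R) :
    (forall f g x, (forall y, m y < m x -> f y = g y) -> Phi f x = Phi g x) ->
  exists f, forall x, f x = Phi f x.
Proof.
move=> PhiP; pose f n := iter n Phi (fun _ => a).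
have fS n x : m x < n -> f n x = f n.+1 x.
  elim: n x => // n IHn x; rewrite ltnS => le_mx.
  by apply: PhiP => y lt_y; apply/IHn/(leq_trans lt_y).
by exists (f (\max_x m x).+1) => x; apply: fS; rewrite ltnS leq_bigmax.
Qed.

(** The length of a shortest path from [r] works: the last vertex but one of such a path is strictly
    closer. *)
Lemma dist_exists (V : finType) (e : rel V) r :
  exists d : V -> nat, d r = 0 /\
    forall u, connect e r u -> u != r -> exists2 w, e w u & d w < d u.
Proof.
pose P u n := [exists t : n.-tuple V, path e r t && (last r t == u)].
have ex u : exists n, (connect e r u ->
    P u n /\ forall p, path e r p -> last r p = u -> n <= size p).
  have [/connectP[p ep ->]|_] := boolP (connect e r u); last by exists 0.
  have PP q : path e r q -> P (last r q) (size q).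
    by move=> eq_; apply/existsP; exists (in_tuple q); rewrite eq_ /=.
  have exP : exists n, P (last r p) n by exists (size p); apply: PP.
  exists (ex_minn exP) => _; case: ex_minnP => m Pm mmin; split=> // q eq_ lq.
  by apply: mmin; rewrite -lq; apply: PP.
have [d dP] := fin_all_exists ex; exists d; split=> [|u ru uNr].
  have [_ /(_ [::] isT erefl)] := dP r (connect0 _ _).
  by rewrite leqn0 => /eqP.
have [/existsP[[p /= /eqP sz] /andP[ep /eqP lp]] _] := dP u ru.
case: (lastP p) ep lp sz => [_ /= ur|q w]; first by rewrite ur eqxx in uNr.
rewrite rcons_path last_rcons size_rcons => /andP[eq_ ew] <- <-.
exists (last r q) => //; rewrite ltnS.
have rl : connect e r (last r q) by apply/connectP; exists q.
by have [_ ->] := dP _ rl.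
Qed.

(** * Rooted forests and parity subgraphs *)

Section Tree.

Variables (X Y : finType) (pX : X -> Y) (pY : Y -> X).
Variables (rX : X -> nat) (rY : Y -> nat).

(** Edges from a vertex to its parent. The parent maps are total, so a parent counts only where the
    rank drops; this drop also excludes cycles. *)
Definition tree_edge x y :=
  (pX x == y) && (rY y < rX x) || (pY y == x) && (rX x < rY y).

Lemma degX_tree (uX : pred X) (uY : pred Y) (J : X -> Y -> bool) x :
    (uX x -> rY (pX x) < rX x) -> (forall y, uY y -> rX (pY y) < rY y) ->
    (forall y, J x y = uX x && (pX x == y) || uY y && (pY y == x)) ->
  degX J x = uX x + #|[pred y | uY y && (pY y == x)]|.
Proof.
move=> hX hY JE; case ux: (uX x) => /=; last first.
  by apply: eq_card => y; rewrite !inE JE ux.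
rewrite /degX (cardD1 (pX x)) !inE JE ux eqxx; congr (_ + _).
apply: eq_card => y; rewrite !inE JE ux eq_sym /=.
case: eqP => //= <-; case: (boolP (uY _)) => //= uy; apply/esym/negP => /eqP px.
by have := hY _ uy; rewrite px ltnNge ltnW // hX.
Qed.

End Tree.

(** From the leaves towards the roots, the edge from a vertex to its parent is taken or not so as to
    correct the parity left by the edges to its children. Vertices outside [uX] and [uY] act as
    roots, and their parity is not controlled. *)
Lemma tree_join (X Y : finType) (pX : X -> Y) (pY : Y -> X)
    (rX : X -> nat) (rY : Y -> nat) (uX : pred X) (uY : pred Y)
    (tX : pred X) (tY : pred Y) :
    (forall x, uX x -> rY (pX x) < rX x) -> (forall y, uY y -> rX (pY y) < rY y) ->
  exists J : X -> Y -> bool,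
    [/\ forall x y, J x y -> uX x && (pX x == y) || uY y && (pY y == x),
        forall x, uX x -> odd (degX J x) = tX x
      & forall y, uY y -> odd (degY J y) = tY y].
Proof.
move=> hX hY.
pose m (u : X + Y) := match u with inl x => rX x | inr y => rY y end.
pose M := \max_u m u.
pose Phi (f : X + Y -> bool) u := match u with
  | inl x => tX x (+) odd #|[pred y | uY y && f (inr y) && (pY y == x)]|
  | inr y => tY y (+) odd #|[pred x | uX x && f (inl x) && (pX x == y)]|
  end.
have leM u : m u <= M by apply: leq_bigmax.
(* [s u] decides on the parent edge of [u]; reversing the rank puts children before parents. *)
have [|s sP] := @rank_rec (X + Y)%type bool (fun u => M - m u) Phi false.
  move=> f g [x|y] fg /=; congr (_ (+) odd _); apply: eq_card => z; rewrite !inE.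
    case: (boolP (uY z)) => //= uz; case: eqP => [pz|_]; last by rewrite !andbF.
    rewrite fg // ltn_sub2l //= -?pz ?hY //.
    by apply: leq_trans (leM (inr z)); rewrite /= hY.
  case: (boolP (uX z)) => //= uz; case: eqP => [pz|_]; last by rewrite !andbF.
  rewrite fg // ltn_sub2l //= -?pz ?hX //.
  by apply: leq_trans (leM (inl z)); rewrite /= hX.
pose vX x := uX x && s (inl x); pose vY y := uY y && s (inr y).
pose J x y := vX x && (pX x == y) || vY y && (pY y == x).
have hvX x : vX x -> rY (pX x) < rX x by case/andP => /hX.
have hvY y : vY y -> rX (pY y) < rY y by case/andP => /hY.
exists J; split=> [x y|x ux|y uy].
- by case/orP=> /andP[/andP[-> _] ->]; rewrite ?orbT.
- rewrite (@degX_tree _ _ pX pY rX rY vX vY) //; last exact: hvX.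
  by rewrite oddD oddb /vX /vY ux /= sP /= -addbA addbb addbF.
- rewrite -[degY J y]/(degX (fun y x => J x y) y).
  rewrite (@degX_tree _ _ pY pX rY rX vY vX (fun y x => J x y)) //; first last.
  + by move=> x; rewrite /J orbC.
  + exact: hvY.
  by rewrite oddD oddb /vX /vY uy /= sP /= -addbA addbb addbF.
Qed.

(** * Two colours on a forest *)

(** This colours the edges at one vertex, [M] being its neighbours. One class suffices if [#|M|] is
    odd or all of [M] lies in [D]; otherwise one element outside [D] is split off, leaving a class
    of odd size. *)
Lemma local_split (X : finType) (M D : pred X) :
    {subset D <= M} -> (#|D| = 1 -> 2 < #|M|) ->
  exists k : X -> bool, forall x, x \in M ->
    let s := #|[pred z | M z && (k z == k x)]| in
    if x \in D then s != 1 else odd s.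
Proof.
move=> sDM D1; have [odM|evM] := boolP (odd #|M|).
  exists (fun _ => false) => x xM /=.
  have -> : #|[pred z | M z && (false == false)]| = #|M|.
    by apply: eq_card => z; rewrite !inE andbT.
  case: ifP => // xD; apply: contraTneq odM => M1.
  have /D1 : #|D| = 1.
    apply/eqP; rewrite eqn_leq -{1}M1 (subset_leq_card (introT subsetP sDM)).
    by apply/card_gt0P; exists x.
  by rewrite M1.
have [sMD|] := boolP (M \subset D).
  exists (fun _ => false) => x xM /=.
  have -> : #|[pred z | M z && (false == false)]| = #|M|.
    by apply: eq_card => z; rewrite !inE andbT.
  by rewrite (subsetP sMD) //; apply: contraNneq evM => ->.
case/subsetPn => a aM aD; exists (pred1 a) => x xM /=.
have cM : #|M| = #|[pred z | M z && (z != a)]|.+1.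
  rewrite (cardD1 a) aM add1n; congr _.+1.
  by apply: eq_card => z; rewrite !inE andbC.
have [-> | xa] := eqVneq x a.
  rewrite (negPf aD) (_ : #|_| = 1) // -(card1 a).
  apply: eq_card => z; rewrite !inE eqb_id andbC.
  by case: eqP => // ->.
rewrite (_ : #|_| = #|[pred z | M z && (z != a)]|); last first.
  by apply: eq_card => z; rewrite !inE eqbF_neg.
move: evM; rewrite cM /= negbK => odd_s; case: ifP => // xD.
apply/eqP => s1; have /D1 : #|D| = 1.
  apply/eqP; rewrite eqn_leq andbC; apply/andP; split; first by apply/card_gt0P; exists x.
  rewrite -s1; apply/subset_leq_card/subsetP => z zD; rewrite inE.
  by rewrite [M z]sDM //; apply: contraNneq aD => <-.
by rewrite cM s1.
Qed.

(** At an odd [x] the edge to [sg x] gets one colour and the evenly many others the opposite one; an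
    even [x] uses a single colour. So a class has degree 1 at [x] on the edge to [sg x] and even
    degree otherwise, and [local_split] gives matching conditions at each [y]. *)
Lemma forest_dec2 (X Y : finType) (J : X -> Y -> bool)
    (pX : X -> Y) (pY : Y -> X) (rX : X -> nat) (rY : Y -> nat)
    (N : pred X) (sg : X -> Y) :
    (forall x y, J x y -> tree_edge pX pY rX rY x y) ->
    (forall x, N x -> J x (sg x)) ->
    (forall x, odd (degX J x) = N x) ->
    (forall y, #|[pred x | N x && (sg x == y)]| = 1 -> 2 < degY J y) ->
  li_dec 2 J.
Proof.
move=> Jtree Jsg oddJ Jleaf.
have kex y : exists k : X -> bool, forall x, J x y ->
    let s := #|[pred z | J z y && (k z == k x)]| in
    if N x && (sg x == y) then s != 1 else odd s.
  apply: (@local_split _ [pred x | J x y]) (Jleaf y) => x /=.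
  by rewrite !inE => /andP[/Jsg Jx /eqP<-].
have [k kP] := fin_all_exists kex.
pose flip x y := N x && (y != sg x).
(* The local colouring at [y] may be swapped as a whole. The swap is fixed by the edge from [y] to
   its parent [z], and then fixes the colour of each child [x]; at roots [false] is chosen. *)
pose Phi (u : X -> bool) x :=
  let y := pX x in let z := pY y in
  (rY y < rX x) && (k y x (+) flip x y (+)
    ((rX z < rY y) && (k y z (+) flip z y (+) u z))).
have [|u uP] := @rank_rec X bool rX Phi false.
  move=> f g x fg; rewrite /Phi /=; case: (ltnP (rY _)) => //= lt1.
  case: (ltnP (rX _)) => //= lt2; congr (_ (+) (_ (+) _)); apply: fg.
  exact: ltn_trans lt2 lt1.
pose c x y := u x (+) flip x y.
pose t y := let z := pY y in (rX z < rY y) && (k y z (+) flip z y (+) u z).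
have cE x y : J x y -> c x y = k y x (+) t y.
  move=> /Jtree/orP[]/andP[/eqP<- lt]; last first.
    by rewrite /t lt /c /= addbC !addbA addbb.
  rewrite /c uP /Phi lt /= -/(t _) -!addbA; congr (_ (+) _).
  by rewrite addbC -addbA addbb addbF.
exists (fun x y => nat_of_bool (c x y)); split=> [x y _|i x y]; first by case: (c x y).
case/andP=> Jxy /eqP ci; rewrite -{}ci.
have eqb z w x' y' : (nat_of_bool (c z w) == c x' y') = (c z w == c x' y').
  by case: (c z w); case: (c x' y').
have -> : degY (colour_class J (fun x y => nat_of_bool (c x y)) (c x y)) y
    = #|[pred z | J z y && (k y z == k y x)]|.
  apply: eq_card => z; rewrite !inE /colour_class eqb.
  by case Jzy: (J z y) => //=; rewrite !cE //; case: (t y); case: (k y z); case: (k y x).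
have -> : degX (colour_class J (fun x y => nat_of_bool (c x y)) (c x y)) x
    = #|[pred z | J x z && (flip x z == flip x y)]|.
  apply: eq_card => z; rewrite !inE /colour_class eqb.
  by rewrite /c; case: (u x); case: (flip x z); case: (flip x y).
have := kP _ _ Jxy; rewrite /flip /=; case Nx: (N x) => /=; last first.
  have -> : #|[pred z | J x z && (false == false)]| = degX J x.
    by apply: eq_card => z; rewrite !inE andbT.
  by apply: contraTneq => <-; rewrite oddJ Nx.
have sgE := cardD1 (sg x) [pred z | J x z].
rewrite !inE Jsg // in sgE.
have [<- | nsg] := eqVneq (sg x) y; rewrite ?eqxx /=.
  have -> : #|[pred z | J x z && ((z != sg x) == false)]| = 1; last by rewrite eq_sym.
  rewrite -(card1 (sg x)); apply: eq_card => z; rewrite !inE eqbF_neg negbK andbC.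
  by case: eqP => //= ->; apply: Jsg.
apply: contraTneq => <-.
have -> : #|[pred z | J x z && ((z != sg x) == ~~ false)]|
    = #|[predD1 [pred z | J x z] & sg x]|.
  by apply: eq_card => z; rewrite !inE eqb_id andbC.
by move: (oddJ x); rewrite Nx /degX sgE.
Qed.

(** * Connectivity and spanning trees *)

Definition adj2 (X Y : finType) (E : X -> Y -> bool) : rel (X + Y) := fun u v =>
  match u, v with
  | inl x, inr y | inr y, inl x => E x y
  | _, _ => false
  end.

(** Isolated vertices are ignored, and a vertex of [Y] on an edge is reached through that edge. *)
Definition bi_connected (X Y : finType) (E : X -> Y -> bool) :=
  forall x y x' y', E x y -> E x' y' -> connect (adj2 E) (inl x) (inl x').

(** A breadth-first tree with distances as ranks. The last clause puts all edges at the root into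
    the tree. *)
Lemma spanning_tree (X Y : finType) (E : X -> Y -> bool) (x0 : X) (r : Y) :
    bi_connected E -> E x0 r ->
  exists (pX : X -> Y) (pY : Y -> X) (rX : X -> nat) (rY : Y -> nat),
    [/\ forall x, 0 < degX E x -> E x (pX x) /\ rY (pX x) < rX x,
        forall y, y != r -> 0 < degY E y -> E (pY y) y /\ rX (pY y) < rY y,
        rY r = 0 & forall x, E x r -> pX x = r].
Proof.
move=> conE Er; have [d [d0 dP]] := dist_exists (adj2 E) (inr r).
have rx x y : E x y -> connect (adj2 E) (inr r) (inl x).
  move=> Exy; apply: connect_trans (conE _ _ _ _ Er Exy).
  by apply: connect1; rewrite /= Er.
have ry x y : E x y -> connect (adj2 E) (inr r) (inr y).
  by move=> Exy; apply: connect_trans (rx _ _ Exy) _; apply: connect1.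
have exX x : exists y, 0 < degX E x ->
    [/\ E x y, d (inr y) < d (inl x) & E x r -> y = r].
  case Exr: (E x r).
    exists r => _; split=> //; rewrite d0 lt0n; apply/eqP => dx.
    have [//|//|w _] := dP (inl x); [exact: rx Exr | by rewrite dx].
  have [/card_gt0P[y Exy]|_] := boolP (0 < _); last by exists r.
  have [//|//|[//|z] Exz lt] := dP (inl x); first exact: rx Exy.
  by exists z.
have exY y : exists x, y != r -> 0 < degY E y ->
    E x y /\ d (inl x) < d (inr y).
  have [-> | yr] := eqVneq y r; first by exists x0.
  have [/card_gt0P[x Exy]|_] := boolP (0 < _); last by exists x0.
  have [//|//|[z|//] Exz lt] := dP (inr y); first exact: ry Exy.
  by exists z.
have [pX pXP] := fin_all_exists exX; have [pY pYP] := fin_all_exists exY.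
exists pX, pY, (d \o inl), (d \o inr); split=> // [x /pXP[]//|x Exr].
by have [_ _ ->] := pXP _ (degX_gt0 Exr).
Qed.

Lemma degX_point (X Y : finType) (J J1 : X -> Y -> bool) x (b : bool) s :
    (forall y, J x y = J1 x y || b && (y == s)) -> (b -> ~~ J1 x s) ->
  degX J x = degX J1 x + b.
Proof.
move=> JE J1s; rewrite (@degX_add _ _ J J1 (fun x' y => b && (y == s)) x) //.
  congr (_ + _); case: b {JE J1s} => /=; last exact: eq_card0.
  by rewrite -(card1 s); apply: eq_card.
by move=> y J1y; apply/negP => /andP[/J1s/negP n /eqP ys]; apply: n; rewrite -ys.
Qed.

Lemma degX_sub (X Y : finType) (E J : X -> Y -> bool) x :
    (forall y, J x y -> E x y) ->
  degX E x = degX J x + degX (fun x y => E x y && ~~ J x y) x.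
Proof.
move=> JE; apply: degX_add => y; last by move=> ->; rewrite andbF.
by case: (boolP (J x y)) => [/JE->|]; rewrite ?andbT.
Qed.

Lemma degX0 (X Y : finType) (E J : X -> Y -> bool) x :
  (forall y, J x y -> E x y) -> degX E x = 0 -> degX J x = 0.
Proof.
move=> JE E0; apply/eqP; rewrite -leqn0 -E0; apply/subset_leq_card/subsetP => y.
exact: JE.
Qed.

Lemma degY_sub (X Y : finType) (E J : X -> Y -> bool) y :
    (forall x, J x y -> E x y) ->
  degY E y = degY J y + degY (fun x y => E x y && ~~ J x y) y.
Proof. exact: (@degX_sub Y X (fun y x => E x y) (fun y x => J x y)). Qed.

Lemma degY0 (X Y : finType) (E J : X -> Y -> bool) y :
  (forall x, J x y -> E x y) -> degY E y = 0 -> degY J y = 0.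
Proof. exact: (@degX0 Y X (fun y x => E x y) (fun y x => J x y)). Qed.

(** * Three colours on a forest with a star *)

Section StarForest.

(* [K] is [J] together with all the edges [N x v] at a vertex [v] missed by
   the forest [J]. *)
Variables (X Y : finType) (J K : X -> Y -> bool).
Variables (pX : X -> Y) (pY : Y -> X) (rX : X -> nat) (rY : Y -> nat).
Variables (N : pred X) (v : Y).
Hypothesis Jtree : forall x y, J x y -> tree_edge pX pY rX rY x y.
Hypothesis Jv : forall x, ~~ J x v.
Hypothesis oddJ : forall x, odd (degX J x) = N x.
Hypothesis KE : forall x y, K x y = J x y || N x && (y == v).

Lemma other_end : exists sg : X -> Y, forall x, N x -> J x (sg x) /\ sg x != v.
Proof.
suff /fin_all_exists : forall x, exists y, N x -> J x y /\ y != v by [].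
move=> x; case Nx: (N x); last by exists v.
have /card_gt0P[y Jy] : 0 < degX J x by apply: odd_gt0; rewrite oddJ.
by exists y => _; split=> //; apply: contraTneq Jy => ->; apply: Jv.
Qed.

(** The new colour takes the star at [v] and the edge from [x] to [sg x] for each [bad] [x], that
    is, where the last hypothesis of [forest_dec2] would fail. In this colour [v] has degree at
    least 3, each [x] at most 2, and [sg x] degree 1 against degree 2 at a bad [x]. Bad vertices
    become even in the remaining forest. *)
Lemma star_forest_big : 2 < #|N| -> li_dec 3 K.
Proof.
move=> n_gt2; have [sg sgP] := other_end.
have NJ x : N x -> J x (sg x) by case/sgP.
have Nv x : N x -> (sg x == v) = false by case/sgP => _ /negPf.
pose D y := [pred x | N x && (sg x == y)].
pose bad x := [&& N x, #|D (sg x)| == 1 & degY J (sg x) <= 2].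
have badN x : bad x -> N x by case/and3P.
pose green x y := N x && (y == v) || bad x && (y == sg x).
pose J2 x y := J x y && ~~ (bad x && (y == sg x)).
apply: (@li_dec_add _ _ 1 2 _ green J2).
- move=> x y; rewrite KE /green /J2.
  have [-> | yv] := eqVneq y v.
    by rewrite (negPf (Jv x)) /bad /= orbF; case: (N x).
  rewrite !andbF !orbF /=; case: (boolP (bad x && _)) => [/andP[/badN/NJ Jx /eqP->]|].
    by rewrite Jx.
  by rewrite andbT.
- move=> x y /orP[/andP[_ /eqP->]|bs]; first by rewrite /J2 negb_and Jv.
  by rewrite /J2 bs andbF.
- apply: li_dec1 => x y.
  have gX : degX green x = N x + bad x.
    rewrite (@degX_point _ _ green (fun x y => N x && (y == v)) x (bad x) (sg x)) //.
      congr (_ + _); rewrite (@degX_point _ _ _ (fun _ _ => false) x (N x) v) //.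
      by rewrite [degX _ x]eq_card0.
    by move=> /badN Nx; rewrite Nv // andbF.
  have [-> _ | yv] := eqVneq y v.
    have -> : degY green v = #|N|.
      apply: eq_card => z; rewrite !inE /green eqxx andbT eq_sym.
      by rewrite /bad -topredE /=; case: (N z).
    rewrite gX neq_ltn (leq_trans _ n_gt2) ?orbT //.
    by case: (N x); case: (bad x).
  rewrite /green (negPf yv) andbF /= => /andP[bx /eqP ys].
  rewrite gX bx badN // neq_ltn; apply/orP; right.
  have /and3P[_ /eqP D1 _] := bx; apply: (@leq_ltn_trans #|D (sg x)|); last by rewrite D1.
  apply/subset_leq_card/subsetP => z.
  rewrite !inE /green (negPf yv) andbF /= ys => /andP[bz /eqP->].
  by rewrite badN //=.
apply: (@forest_dec2 _ _ J2 pX pY rX rY (fun x => N x && ~~ bad x) sg).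
- by move=> x y /andP[/Jtree].
- by move=> x /andP[Nx nbx]; rewrite /J2 (negPf nbx) NJ.
- move=> x; have := oddJ x; rewrite (@degX_point _ _ J J2 x (bad x) (sg x)).
  + rewrite oddD oddb; case: (boolP (bad x)) => [/badN->|_].
      by rewrite addbT => /negbTE ->.
    by rewrite addbF andbT.
  + move=> y; rewrite /J2; case: (boolP (bad x && _)) => [/andP[/badN/NJ Jx /eqP->]|].
      by rewrite Jx.
    by rewrite andbT orbF.
  by move=> bx; rewrite /J2 bx eqxx andbF.
move=> y D1; have /card_gt0P[x] : 0 < #|[pred x | (N x && ~~ bad x) && (sg x == y)]|.
  by rewrite D1.
rewrite inE => /andP[/andP[Nx nbx] /eqP sx].
have nbad : #|D y| == 1 -> 2 < degY J y.
  by move=> Dy; rewrite ltnNge; apply: contra nbx => le2; rewrite /bad Nx sx Dy le2.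
have nb z : sg z = y -> ~~ bad z.
  move=> sz; apply/negP => /and3P[_]; rewrite sz => /nbad.
  by rewrite ltnNge => /negP.
have DE : #|D y| == 1.
  rewrite -D1; apply/eqP/eq_card => z; rewrite !inE.
  by case: eqP => [/nb->|_]; rewrite ?andbT ?andbF.
rewrite (_ : degY J2 y = degY J y) ?nbad //; apply: eq_card => z; rewrite !inE /J2.
by have [/esym/nb/negPf->|] := eqVneq y (sg z); rewrite ?andbF /= andbT.
Qed.

(** The edge from [x0] to [v] joins the forest and makes [x0] even. If [N] has another vertex, its
    edges to [v] and [sg x] form a path of length two in the new colour, which leaves it even as
    well. *)
Lemma star_forest_small x0 : N x0 -> #|N| <= 2 -> li_dec 3 K.
Proof.
move=> Nx0 n_le2; have [sg sgP] := other_end.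
have NJ x : N x -> J x (sg x) by case/sgP.
have Nv x : N x -> (sg x == v) = false by case/sgP => _ /negPf.
pose bad x := N x && (x != x0).
have badN x : bad x -> N x by case/andP.
have bad1 x y : bad x -> bad y -> x = y.
  move=> bx by_; apply/eqP; apply/negPn/negP => xy.
  have : #|[:: x0; x; y]| <= #|N|.
    apply/subset_leq_card/subsetP => z; rewrite !inE.
    by case/or3P=> /eqP-> //; apply: badN.
  rewrite (card_uniqP _) /=; first by rewrite leqNgt ltnS n_le2.
  case/andP: bx => _ xx; case/andP: by_ => _ yx.
  by rewrite !inE !negb_or eq_sym xx eq_sym yx xy.
pose green x y := bad x && ((y == v) || (y == sg x)).
pose J2 x y := J x y && ~~ (bad x && (y == sg x)) || (x == x0) && (y == v).
apply: (@li_dec_add _ _ 1 2 _ green J2).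
- move=> x y; rewrite KE /green /J2.
  have [-> | yv] := eqVneq y v.
    rewrite (negPf (Jv x)) /= !andbT /bad; case: (eqVneq x x0) => [->|]; rewrite ?Nx0 //.
    by rewrite andbT orbF.
  rewrite !andbF !orbF /=; case: (boolP (bad x && _)) => [/andP[/badN/NJ Jx /eqP->]|].
    by rewrite Jx.
  by rewrite andbT.
- move=> x y /andP[bx ye]; rewrite /J2 bx /=; case/andP: bx => Nx /negPf->.
  by rewrite orbF; case/orP: ye => [/eqP->|->]; rewrite ?andbF // negb_and Jv.
- apply: li_dec1 => x y /andP[bx _].
  rewrite (@degX_point _ _ green (fun x y => (y == v)) x (bad x) (sg x)); last first.
  + by move=> /badN Nx; rewrite Nv.
  + by move=> z; rewrite /green bx.
  rewrite bx neq_ltn; apply/orP; right; apply: (@leq_ltn_trans 1).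
    rewrite -(card1 x); apply/subset_leq_card/subsetP => z.
    by rewrite !inE => /andP[/bad1/(_ bx)->].
  by rewrite addn1 ltnS; apply/card_gt0P; exists v; rewrite inE.
(* [v] is hung below [x0] as a leaf, with a rank exceeding that of [x0]. *)
apply: (@forest_dec2 _ _ J2 pX (fun y => if y == v then x0 else pY y) rX
          (fun y => if y == v then (maxn (rX x0) (rY v)).+1 else rY y) pred0 sg) => //.
- move=> x y /orP[/andP[Jxy _]|/andP[/eqP-> /eqP->]]; last first.
    by rewrite /tree_edge !eqxx ltnS leq_maxl orbT.
  have /negPf yv : y != v by apply: contraTneq Jxy => ->; apply: Jv.
  have := Jtree Jxy; rewrite /tree_edge yv; case/orP=> /andP[/eqP <- lt].
    by rewrite eqxx lt.
  by rewrite eqxx lt orbT.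
- move=> x; apply/negbTE.
  rewrite (@degX_point _ _ J2 (fun x y => J x y && ~~ (bad x && (y == sg x))) x (x == x0) v) //.
    have := oddJ x; rewrite (@degX_point _ _ J (fun x y => J x y && ~~ (bad x && (y == sg x)))
      x (bad x) (sg x)).
    + have [->|xx0] := eqVneq x x0.
        by rewrite !oddD Nx0 /= /bad eqxx andbF addbF => ->.
      have bE : bad x = N x by rewrite /bad xx0 andbT.
      by rewrite addn0 oddD oddb bE; case: (odd _); case: (N x).
    + move=> y; case: (boolP (bad x && _)) => [/andP[/badN/NJ Jx /eqP->]|].
        by rewrite Jx.
      by rewrite andbT orbF.
    by move=> bx; rewrite bx eqxx andbF.
  by move=> _; rewrite negb_and Jv.
by move=> y; rewrite eq_card0.
Qed.

End StarForest.

(** * Even degrees on one side: four colours *)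

Lemma odd_degX_sub (X Y : finType) (E J : X -> Y -> bool) x :
    (forall y, J x y -> E x y) ->
  odd (degX (fun x y => E x y && ~~ J x y) x) = odd (degX E x) (+) odd (degX J x).
Proof. by move=> JE; rewrite (degX_sub JE) oddD addbC addbA addbb. Qed.

Lemma odd_degY_sub (X Y : finType) (E J : X -> Y -> bool) y :
    (forall x, J x y -> E x y) ->
  odd (degY (fun x y => E x y && ~~ J x y) y) = odd (degY E y) (+) odd (degY J y).
Proof. by move=> JE; rewrite (degY_sub JE) oddD addbC addbA addbb. Qed.

Lemma even_sum_degY (X Y : finType) (E : X -> Y -> bool) :
  (forall x, ~~ odd (degX E x)) -> ~~ odd (\sum_y degY E y).
Proof.
by move=> ev; rewrite -sum_deg odd_sum big1 // => x _; rewrite (negPf (ev x)).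
Qed.

Lemma li_dec_sub (X Y : finType) (E J : X -> Y -> bool) k1 k2 :
    (forall x y, J x y -> E x y) ->
    li_dec k1 J -> li_dec k2 (fun x y => E x y && ~~ J x y) ->
  li_dec (k1 + k2) E.
Proof.
move=> JE; apply: li_dec_add => x y; last by move=> ->; rewrite andbF.
by case: (boolP (J x y)) => [/JE->|]; rewrite ?andbT.
Qed.

Section EvenConnected.

Variables (X Y : finType) (K : X -> Y -> bool).
Hypothesis Kconn : bi_connected K.
Hypothesis Keven : forall x, ~~ odd (degX K x).

Lemma even_connected_dec4 : li_dec 4 K.
Proof.
have [/existsP[x0 /existsP[r Kr]]|/existsPn K0] := boolP [exists x, exists y, K x y]; last first.
  by apply: li_dec_leq (li_dec_empty _) => // x y; have /existsPn := K0 x; apply.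
have [pX [pY [rX [rY [hX hY r0 pXr]]]]] := spanning_tree Kconn Kr.
(* [J] is even on [X] and, away from [r], odd exactly at the even non-isolated vertices of [Y];
   removing it makes all of these odd. *)
have [||J [JT JX JY]] := @tree_join X Y pX pY rX rY (fun x => 0 < degX K x)
  (fun y => (y != r) && (0 < degY K y)) pred0 (fun y => ~~ odd (degY K y)).
- by move=> x /hX[].
- by move=> y /andP[? /hY[]].
have JK x y : J x y -> K x y.
  move=> /JT/orP[]/andP[h /eqP<-]; first by case: (hX _ h).
  by case/andP: h => yr /(hY _ yr)[].
have Jtree x y : J x y -> tree_edge pX pY rX rY x y.
  rewrite /tree_edge => /JT/orP[]/andP[h /eqP<-]; rewrite eqxx /=.
    by case: (hX _ h) => _ ->.
  by case/andP: h => yr /(hY _ yr)[_ ->]; rewrite orbT.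
have Jev x : odd (degX J x) = false.
  have [/eqP d0|d0] := boolP (degX K x == 0); first by rewrite (degX0 (JK x) d0).
  by rewrite JX // lt0n.
pose L x y := K x y && ~~ J x y.
have Lev x : ~~ odd (degX L x) by rewrite odd_degX_sub ?Jev ?addbF //; apply: JK.
have Lodd y : y != r -> odd (degY L y) = (0 < degY K y).
  move=> yr; have [d0|d0] := posnP (degY K y).
    by rewrite (@degY0 _ _ K) // => x /andP[].
  by rewrite odd_degY_sub => [|x /JK//]; rewrite JY ?yr ?d0 // addbN addbb.
have [Lr|Lr] := boolP (odd (degY L r)).
  apply: (@li_dec_leq _ _ (2 + 1)) => //; apply: (li_dec_sub JK).
    apply: (forest_dec2 Jtree (N := pred0) (sg := fun _ => r)) => // y.
    by rewrite eq_card0.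
  apply: li_dec1; apply: parity_irregular => // y.
  have [-> //|yr] := eqVneq y r.
  rewrite Lodd // => /card_gt0P[x]; rewrite inE => /andP[Kxy _].
  exact: degY_gt0 Kxy.
have Kr0 : 0 < degY K r := degY_gt0 Kr.
(* A vertex of [Y] of maximal rank can be avoided: an [x] with parent [v] has a second neighbour, as
   its degree is even, and by maximality that neighbour also has rank below [rX x]. *)
have [v Kv vmax] := @arg_maxnP _ r (fun y => 0 < degY K y) rY Kr0.
have other x y : K x y -> exists2 z, K x z & z != y.
  move=> Kxy; have : 1 < degX K x.
    by move: (Keven x) (degX_gt0 Kxy); case: (degX K x) => [|[]].
  rewrite /degX (cardD1 y) inE Kxy ltnS => /card_gt0P[z].
  by rewrite !inE => /andP[]; exists z.
have vr : v != r.
  have [z Kz zr] := other _ _ Kr; have [_ lt] := hY _ zr (degY_gt0 Kz).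
  apply: contraTneq (vmax z (degY_gt0 Kz)) => ->.
  by rewrite r0 -ltnNge (leq_ltn_trans _ lt).
have [qX qXP] : exists q : X -> Y, forall x, 0 < degX K x ->
    [/\ K x (q x), q x != v & rY (q x) < rX x].
  suff /fin_all_exists : forall x, exists y, 0 < degX K x ->
    [/\ K x y, y != v & rY y < rX x] by [].
  move=> x; have [d0|d0] := posnP (degX K x); first by exists r.
  have [Kp lt] := hX _ d0; have [pv|pv] := eqVneq (pX x) v; last by exists (pX x).
  have [z Kz zp] := other _ _ Kp; exists z => _; split; rewrite -?pv //.
  by rewrite pv in lt; apply: leq_ltn_trans lt; apply/vmax/degY_gt0/Kz.
(* Deleting [v] makes its neighbours odd; [J'] is odd exactly at them, so removing it restores even
   degrees on [X]. *)
have [||J' [JT' JX' JY']] := @tree_join X Y qX pY rX rY (fun x => 0 < degX K x)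
  (fun y => [&& y != v, y != r & (0 < degY K y)])
  (fun x => K x v) (fun y => ~~ odd (degY K y)).
- by move=> x /qXP[].
- by move=> y /and3P[_ ? /hY[]].
have JK' x y : J' x y -> K x y && (y != v).
  move=> /JT'/orP[]/andP[h /eqP<-]; first by case: (qXP _ h) => -> ->.
  by case/and3P: h => -> yr /(hY _ yr)[->].
have Jtree' x y : J' x y -> tree_edge qX pY rX rY x y.
  rewrite /tree_edge => /JT'/orP[]/andP[h /eqP<-]; rewrite eqxx /=.
    by case: (qXP _ h) => _ _ ->.
  by case/and3P: h => _ yr /(hY _ yr)[_ ->]; rewrite orbT.
pose K' x y := K x y && (y != v).
have KK' x : degX K x = degX K' x + K x v.
  apply: (@degX_point _ _ K K' x (K x v) v) => [y|_]; last by rewrite /K' eqxx andbF.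
  by rewrite /K'; have [->|_] := eqVneq y v; rewrite ?andbF ?andbT ?orbF.
have Jodd' x : odd (degX J' x) = K x v.
  have [d0|d0] := posnP (degX K x); last exact: JX'.
  rewrite (degX0 _ d0) => [|y /JK'/andP[]//].
  by apply/esym/negbTE; apply: contra_eqN d0 => /degX_gt0; rewrite lt0n.
pose L' x y := K' x y && ~~ J' x y.
have Lev' x : ~~ odd (degX L' x).
  rewrite odd_degX_sub ?Jodd' => [|y]; last exact: JK'.
  by move: (Keven x); rewrite KK' oddD oddb.
have Lodd' y : y != r -> odd (degY L' y) = (y != v) && (0 < degY K y).
  move=> yr; have [->|yv] := eqVneq y v.
    by rewrite /degY eq_card0 // => x; rewrite !inE /L' /K' eqxx andbF.
  have [d0|d0] := posnP (degY K y).
    by rewrite (@degY0 _ _ K) // => x /andP[/andP[]].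
  rewrite odd_degY_sub => [|x /JK'//]; rewrite JY' ?yr ?yv ?d0 //.
  have -> : degY K' y = degY K y.
    by apply: eq_card => x; rewrite !inE /K' yv andbT.
  by rewrite addbN addbb.
(* Removing [v] changes by one the number of odd degrees besides [r], hence the
   parity at [r]. *)
have Lr' : odd (degY L' r).
  rewrite (odd_root (even_sum_degY Lev') Lodd'); move: Lr.
  rewrite (odd_root (even_sum_degY Lev) Lodd).
  rewrite [in X in X -> _](cardD1 v) !inE vr Kv /= negbK; congr odd.
  by apply: eq_card => y; rewrite !inE andbCA.
have Ldec : li_dec 1 L'.
  apply: li_dec1; apply: parity_irregular => // y.
  have [-> //|yr] := eqVneq y r.
  rewrite Lodd' // => /card_gt0P[x]; rewrite inE => /andP[/andP[Kxy ->] _].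
  exact: degY_gt0 Kxy.
have Jv x : ~~ J' x v by apply/negP => /JK'; rewrite eqxx andbF.
have star : forall x y, K x y && ~~ L' x y = J' x y || K x v && (y == v).
  move=> x y; rewrite /L' /K'; have [->|yv] := eqVneq y v.
    by rewrite andbF andbT (negPf (Jv x)).
  rewrite !andbT andbF orbF; case: (boolP (J' x y)) => [/JK'/andP[-> _]|] //.
  by rewrite andbT andbN.
apply: (@li_dec_sub _ _ _ L' 1 3) => //; first by move=> x y /andP[/andP[]].
have [n_le|n_gt] := leqP (degY K v) 2.
  case/card_gt0P: Kv => x Kxv.
  exact: (star_forest_small Jtree' Jv Jodd' star Kxv n_le).
exact: (star_forest_big Jtree' Jv Jodd' star n_gt).
Qed.

End EvenConnected.

(** * Reduction to connected components *)

Lemma bi_connected_tr (X Y : finType) (E : X -> Y -> bool) :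
  bi_connected E -> bi_connected (fun y x => E x y).
Proof.
move=> Econn y1 x1 y2 x2 E1 E2; set e := adj2 _.
pose sw (u : X + Y) : Y + X := match u with inl x => inr x | inr y => inl y end.
have swP u v : connect (adj2 E) u v -> connect e (sw u) (sw v).
  case/connectP=> p; elim: p u => [|w p IHp] u /= => [_ -> //|/andP[uw ep] lp].
  by apply: connect_trans (IHp _ ep lp); apply: connect1; case: u w uw {ep lp} => [a|a] [b|b].
apply: connect_trans (connect_trans (swP _ _ (Econn _ _ _ _ E1 E2)) _); exact: connect1.
Qed.

Section Components.

Variables (X Y : finType) (E : X -> Y -> bool).

Definition comp u := fingraph.root (adj2 E) u.
Definition comp_rel i x y := E x y && (comp (inl x) == i).

Lemma adj2_sym : connect_sym (adj2 E).
Proof. by apply: sym_connect_sym; case=> [x|y] [z|z]. Qed.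

Lemma comp_adj u v : adj2 E u v -> comp u = comp v.
Proof. by move=> /connect1 ?; apply/(rootP adj2_sym). Qed.

Lemma comp_edge x y : E x y -> comp (inl x) = comp (inr y).
Proof. by move=> Exy; apply: comp_adj. Qed.

Lemma comp_rel_connected i : bi_connected (comp_rel i).
Proof.
move=> x y x' y' /andP[_ /eqP xi] /andP[_ /eqP x'i].
have /connectP[p] : connect (adj2 E) (inl x) (inl x').
  by apply/(rootP adj2_sym); rewrite -/(comp _) xi -x'i.
elim: p (inl x : X + Y) xi => [|v p IHp] u ui /= => [_ ->|/andP[uv ep] lp] //.
have vi : comp v = i by rewrite -(comp_adj uv).
apply: connect_trans (IHp _ vi ep lp); apply: connect1.
case: u v uv ui vi {ep lp IHp} => [z|z] [w|w] //= Ezw ui vi; rewrite /comp_rel Ezw /=.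
  by rewrite ui eqxx.
by rewrite vi eqxx.
Qed.

Lemma li_dec_comp k : (forall i, li_dec k (comp_rel i)) -> li_dec k E.
Proof. exact: (li_dec_label (@comp_edge)). Qed.

Lemma comp_li_dec k i : li_dec k E -> li_dec k (comp_rel i).
Proof. exact: (li_dec_restrict i (@comp_edge)). Qed.

Lemma degX_comp i x : degX (comp_rel i) x = if comp (inl x) == i then degX E x else 0.
Proof.
case: eqP => [xi|/eqP/negPf xi]; last by apply: eq_card0 => y; rewrite !inE /comp_rel xi andbF.
by apply: eq_card => y; rewrite !inE /comp_rel xi eqxx andbT.
Qed.

End Components.

Lemma even_dec4 (X Y : finType) (E : X -> Y -> bool) :
  (forall x, ~~ odd (degX E x)) -> li_dec 4 E.
Proof.
move=> ev; apply: li_dec_comp => i; apply: even_connected_dec4 => [|x].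
  exact: comp_rel_connected.
by rewrite degX_comp; case: ifP.
Qed.

(** * Six colours on a connected graph *)

Section ConnectedDec6.

Variables (X Y : finType) (E : X -> Y -> bool).
Hypothesis Econn : bi_connected E.

(** Since [J] contains every edge at the root [z], the rest has degree 0 there, and no parity
    problem remains at the root. The edges added to [J0] make the vertices of [N] odd; [z] is their
    special neighbour, and its degree above 2 is what [forest_dec2] asks for. *)
Lemma large_degree_dec6 z : 2 < degY E z -> li_dec 6 E.
Proof.
move=> z_gt2; have /card_gt0P[x0 Ez] : 0 < degY E z by apply: leq_trans z_gt2.
have [pX [pY [rX [rY [hX hY _ pXz]]]]] := spanning_tree Econn Ez.
have [||J0 [JT JX JY]] := @tree_join X Y pX pY rX rY (fun x => 0 < degX E x)
  (fun y => (y != z) && (0 < degY E y)) pred0 (fun y => odd (degY E y)).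
- by move=> x /hX[].
- by move=> y /andP[? /hY[]].
have J0E x y : J0 x y -> E x y.
  move=> /JT/orP[]/andP[h /eqP<-]; first by case: (hX _ h).
  by case/andP: h => yr /(hY _ yr)[].
pose N x := E x z && ~~ J0 x z.
pose J x y := J0 x y || N x && (y == z).
have JE x y : J x y -> E x y by case/orP => [/J0E//|/andP[/andP[Exz _] /eqP->]].
have JEz x : J x z = E x z.
  by rewrite /J /N eqxx andbT; case: (boolP (J0 x z)) => [/J0E->|]; rewrite ?andbT.
apply: (@li_dec_sub _ _ _ J 2 4) => //.
  apply: (@forest_dec2 _ _ J pX pY rX rY N (fun _ => z)).
  - move=> x y; rewrite /tree_edge => /orP[/JT/orP[]/andP[h /eqP<-]|/andP[/andP[Exz _] /eqP->]].
    + by case: (hX _ h) => _ ->; rewrite eqxx.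
    + by case/andP: h => yr /(hY _ yr)[_ ->]; rewrite eqxx orbT.
    + by have [_] := hX _ (degX_gt0 Exz); rewrite pXz // eqxx => ->.
  - by move=> x /andP[Exz _]; rewrite JEz.
  - move=> x; rewrite (@degX_point _ _ J J0 x (N x) z) // => [|/andP[]//].
    rewrite oddD oddb; have [d0|d0] := posnP (degX E x); last by rewrite JX.
    by rewrite (degX0 (J0E x) d0).
  - move=> y D1; have /card_gt0P[x] : 0 < #|[pred x | N x && (z == y)]| by rewrite D1.
    rewrite inE => /andP[_ /eqP <-].
    by rewrite (_ : degY J z = degY E z) //; apply: eq_card => w; rewrite !inE JEz.
apply: li_dec_tr; apply: even_dec4 => y.
rewrite -[degX _ y]/(degY (fun x y => E x y && ~~ J x y) y).
rewrite odd_degY_sub => [|x]; last exact: JE.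
have [->|yz] := eqVneq y z.
  by rewrite (_ : degY J z = degY E z) ?addbb //; apply: eq_card => w; rewrite !inE JEz.
rewrite (_ : degY J y = degY J0 y); last first.
  by apply: eq_card => x; rewrite !inE /J (negPf yz) andbF orbF.
have [d0|d0] := posnP (degY E y); first by rewrite d0 (degY0 (J0E^~ y) d0).
by rewrite JY ?addbb // yz.
Qed.

(** [J] has an even number of edges, being even on [X]. So the rest also has an even number, which
    forces an even degree at the root [r]. *)
Lemma even_size_dec6 : ~~ odd (\sum_y degY E y) -> li_dec 6 E.
Proof.
move=> Eev.
have [/existsP[x0 /existsP[r Er]]|/existsPn E0] := boolP [exists x, exists y, E x y]; last first.
  by apply: li_dec_leq (li_dec_empty _) => // x y; have /existsPn := E0 x; apply.
have [pX [pY [rX [rY [hX hY _ _]]]]] := spanning_tree Econn Er.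
have [||J [JT JX JY]] := @tree_join X Y pX pY rX rY (fun x => 0 < degX E x)
  (fun y => (y != r) && (0 < degY E y)) pred0 (fun y => odd (degY E y)).
- by move=> x /hX[].
- by move=> y /andP[? /hY[]].
have JE x y : J x y -> E x y.
  move=> /JT/orP[]/andP[h /eqP<-]; first by case: (hX _ h).
  by case/andP: h => yr /(hY _ yr)[].
have Jev x : odd (degX J x) = false.
  by have [d0|d0] := posnP (degX E x); [rewrite (degX0 (JE x) d0) | rewrite JX].
apply: (@li_dec_sub _ _ _ J 2 4) => //.
  apply: (@forest_dec2 _ _ J pX pY rX rY pred0 (fun _ => r)) => //.
    move=> x y; rewrite /tree_edge => /JT/orP[]/andP[h /eqP<-].
      by case: (hX _ h) => _ ->; rewrite eqxx.
    by case/andP: h => yr /(hY _ yr)[_ ->]; rewrite eqxx orbT.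
  by move=> y; rewrite eq_card0.
pose H x y := E x y && ~~ J x y.
have Hev y : y != r -> odd (degY H y) = pred0 y.
  move=> yr; rewrite odd_degY_sub => [|x]; last exact: JE.
  have [d0|d0] := posnP (degY E y); first by rewrite d0 (degY0 (JE^~ y) d0).
  by rewrite JY ?addbb // yr.
have Hsum : ~~ odd (\sum_y degY H y).
  have : \sum_y degY E y = \sum_y degY J y + \sum_y degY H y.
    by rewrite -big_split; apply: eq_bigr => y _; apply: degY_sub => x; apply: JE.
  move=> eqs; move: Eev; rewrite eqs oddD.
  by rewrite (negPf (even_sum_degY _)) // => x; rewrite Jev.
apply: li_dec_tr; apply: even_dec4 => y; rewrite -[degX _ y]/(degY H y).
have [->|yr] := eqVneq y r; last by rewrite Hev.
by rewrite (odd_root Hsum Hev) eq_card0 // => z; rewrite !inE andbF.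
Qed.

End ConnectedDec6.

(* With all degrees at most 2, a locally irregular decomposition is made of
   paths of length two. *)
Lemma small_degree_even_size (X Y : finType) (E : X -> Y -> bool) k :
    (forall x, degX E x <= 2) -> (forall y, degY E y <= 2) -> li_dec k E ->
  ~~ odd (\sum_y degY E y).
Proof.
move=> dX dY [c [_ irr]].
pose cX x y := degX (colour_class E c (c x y)) x.
pose cY x y := degY (colour_class E c (c x y)) y.
(* Every edge has degrees 1 and 2 within its colour. [A] collects the paths with middle vertex in
   [X], [B] those with middle vertex in [Y]; together they partition [E]. *)
pose A x y := E x y && (cX x y == 2); pose B x y := E x y && (cY x y == 2).
have cle2 x y : E x y -> [/\ 0 < cX x y <= 2, 0 < cY x y <= 2 & cX x y != cY x y].
  move=> Exy; have Cxy : colour_class E c (c x y) x y by rewrite /colour_class Exy eqxx.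
  split; last exact: irr.
    rewrite (degX_gt0 Cxy) (leq_trans _ (dX x)) //.
    by apply/subset_leq_card/subsetP => z /andP[].
  rewrite (degY_gt0 Cxy) (leq_trans _ (dY y)) //.
  by apply/subset_leq_card/subsetP => z /andP[].
have evA x : ~~ odd (degX A x).
  have [->//|] := posnP (degX A x); case/card_gt0P=> y /andP[Exy /eqP c2].
  suff -> : degX A x = 2 by [].
  apply/eqP; rewrite eqn_leq; apply/andP; split.
    by apply: leq_trans (dX x); apply/subset_leq_card/subsetP => z /andP[].
  rewrite -c2; apply/subset_leq_card/subsetP => z; rewrite !inE => /andP[Exz /eqP cz].
  by rewrite /A Exz /cX cz -/(cX x y) c2.
have evB y : ~~ odd (degY B y).
  have [->//|] := posnP (degY B y); case/card_gt0P=> x /andP[Exy /eqP c2].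
  suff -> : degY B y = 2 by [].
  apply/eqP; rewrite eqn_leq; apply/andP; split.
    by apply: leq_trans (dY y); apply/subset_leq_card/subsetP => z /andP[].
  rewrite -c2; apply/subset_leq_card/subsetP => z; rewrite !inE => /andP[Exz /eqP cz].
  by rewrite /B Exz /cY cz -/(cY x y) c2.
have -> : \sum_y degY E y = \sum_y degY A y + \sum_y degY B y.
  rewrite -big_split; apply: eq_bigr => y _; apply: degY_add => x.
    rewrite /A /B; case Exy: (E x y) => //=; have [] := cle2 _ _ Exy.
    by case: (cX x y) (cY x y) => [|[|[]]] // [|[|[]]].
  case/andP=> Exy /eqP c2; rewrite /B Exy /=; have [_ _] := cle2 _ _ Exy.
  by rewrite c2 eq_sym.
rewrite oddD (negPf (even_sum_degY evA)) odd_sum big1 // => y _.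
by rewrite (negPf (evB y)).
Qed.

Lemma li_dec6 (X Y : finType) (E : X -> Y -> bool) k : li_dec k E -> li_dec 6 E.
Proof.
move=> Edec; apply: li_dec_comp => i; have Econn := @comp_rel_connected _ _ E i.
have := comp_li_dec i Edec; move: (comp_rel E i) Econn => K Kconn Kdec.
have [/existsP[y]|/existsPn dY] := boolP [exists y, 2 < degY K y].
  exact: large_degree_dec6.
have [/existsP[x]|/existsPn dX] := boolP [exists x, 2 < degX K x].
  move=> x_gt2; apply: li_dec_tr; apply: (@large_degree_dec6 _ _ _ _ x x_gt2).
  exact: bi_connected_tr.
apply: even_size_dec6 => //; apply: small_degree_even_size Kdec => [x|y].
  by rewrite leqNgt.
by rewrite leqNgt.
Qed.

(** * From bipartite graphs to relations *)

Section Graph.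

Variables (G : sgraph) (A : {set vertex G}).
Hypothesis bipA : forall x y : vertex G, adj x y -> (x \in A) != (y \in A).

(** Each edge is directed out of [A]. Both sides are the whole vertex type; a vertex is isolated on
    the side to which it does not belong. *)
Definition across (x y : vertex G) := adj x y && (x \in A).

Lemma across_notin x y : across x y -> y \notin A.
Proof. by case/andP=> /bipA; case: (x \in A); case: (y \in A). Qed.

Lemma edge_adj (x y : vertex G) : ([set x; y] \in edges G) = adj x y.
Proof.
rewrite inE; apply/existsP/idP => [[u /existsP[v /andP[uv /eqP E]]]|xy]; last first.
  by exists x; apply/existsP; exists y; rewrite xy eqxx.
have /set2P xe : x \in [set u; v] by rewrite -E set21.
have /set2P ye : y \in [set u; v] by rewrite -E set22.
case: xe ye => xe [] ye; rewrite xe ye // 1?adj_sym //.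
  by have := set22 u v; rewrite -E xe ye setUid => /set1P vu; rewrite vu in uv.
by have := set21 u v; rewrite -E xe ye setUid => /set1P vu; rewrite vu in uv.
Qed.

Lemma across_inj x y x' y' :
  across x y -> across x' y' -> [set x; y] = [set x'; y'] -> x = x' /\ y = y'.
Proof.
move=> xy xy' E; have yA := across_notin xy; have yA' := across_notin xy'.
case/andP: xy => _ xA; case/andP: xy' => _ xA'.
have : x \in [set x'; y'] by rewrite -E set21.
have : y \in [set x'; y'] by rewrite -E set22.
rewrite !inE => /orP[]/eqP ye /orP[]/eqP xe //.
- by rewrite ye xA' in yA.
- by rewrite ye xA' in yA.
- by rewrite xe (negPf yA') in xA.
Qed.

(** Within a colour, the degree in the graph is [degX] at vertices of [A] and [degY] elsewhere, and
    every edge has one end of each kind. *)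
Lemma li_coloring_irregular k (c : {ffun edge G -> 'I_k}) col :
    (forall x y (e : edge G), across x y -> val e = [set x; y] -> c e = col x y :> nat) ->
  li_coloring c <-> forall i : 'I_k, irregular (colour_class across col i).
Proof.
move=> c_col.
have classE (i : 'I_k) x y : x \in A -> class_adj c i x y = colour_class across col i x y.
  move=> xA; apply/existsP/andP => [[e /andP[/eqP ve /eqP <-]]|[xy /eqP ci]].
    have xy : across x y by rewrite /across xA -edge_adj -ve (valP e).
    by rewrite (c_col _ _ _ xy ve) eqxx.
  have eP : [set x; y] \in edges G by rewrite edge_adj; case/andP: xy.
  exists (exist (fun e => e \in edges G) _ eP : edge G); rewrite /= eqxx /= -val_eqE /= -ci; apply/eqP.
  exact: c_col.
have degA (i : 'I_k) x : x \in A ->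
    @degree (color_class c i) x = degX (colour_class across col i) x.
  by move=> xA; apply: eq_card => y; rewrite !inE /= classE.
have degB (i : 'I_k) y : y \notin A ->
    @degree (color_class c i) y = degY (colour_class across col i) y.
  move=> yA; apply: eq_card => x; rewrite !inE /= class_adj_sym.
  have [xA|xA] := boolP (x \in A); first by rewrite classE.
  rewrite /colour_class /across (negPf xA) andbF /=; apply/negbTE/existsP => -[e].
  case/andP=> /eqP ve _; have := valP e; rewrite ve edge_adj => /bipA.
  by rewrite (negPf xA) (negPf yA).
split=> [/forallP li i x y xy|irr].
  have xA : x \in A by case/andP: xy => /andP[].
  have yA : y \notin A by case/andP: xy => /across_notin.
  have /forallP/(_ x)/forallP/(_ y) := li i.
  by rewrite /= classE // xy degA // degB.
apply/forallP => i; apply/forallP => x; apply/forallP => y; apply/implyP => /= xy.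
wlog xA : x y xy / x \in A.
  move=> hw; have [xA|xA] := boolP (x \in A); first exact: hw.
  rewrite eq_sym; apply: hw; first by rewrite class_adj_sym.
  have /existsP[e /andP[/eqP ve _]] := xy; have := valP e; rewrite ve edge_adj => /bipA.
  by rewrite (negPf xA); case: (y \in A).
rewrite classE // in xy; have yA : y \notin A by case/andP: xy => /across_notin.
by rewrite degA // degB //; apply: irr.
Qed.

Lemma li_colorable_dec k : li_colorable G k <-> li_dec k across.
Proof.
split=> [/existsP[c li]|[col [colk irr]]].
  (* The value 0 is a default for pairs that are not edges. *)
  pose col x y := if insub [set x; y] is Some e then val (c e) else 0.
  have colE x y (e : edge G) : across x y -> val e = [set x; y] -> c e = col x y :> nat.
    by move=> _ ve; rewrite /col -ve valK.
  have colk x y : across x y -> col x y < k.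
    move=> xy; have eP : [set x; y] \in edges G by rewrite edge_adj; case/andP: xy.
    by rewrite -(colE _ _ (exist (fun e => e \in edges G) _ eP)).
  exists col; split=> // i x y; have [lt|le] := ltnP i k.
    exact: (proj1 (li_coloring_irregular colE) li (Ordinal lt)).
  by case/andP=> /colk lt /eqP ci; rewrite ci ltnNge le in lt.
have exc (e : edge G) : exists i : 'I_k,
    forall x y, across x y -> val e = [set x; y] -> i = col x y :> nat.
  have := valP e; rewrite inE => /existsP[x /existsP[y /andP[xy /eqP ve]]].
  wlog xA : x y xy ve / x \in A.
    move=> hw; have [xA|xA] := boolP (x \in A); first exact: (hw x y).
    apply: (hw y x); rewrite ?[adj y x]adj_sym // 1?setUC //.
    by move: (bipA xy); rewrite (negPf xA); case: (y \in A).
  have axy : across x y by rewrite /across xy.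
  exists (Ordinal (colk _ _ axy)) => x' y' axy' /=; rewrite ve.
  by case/(across_inj axy axy') => -> ->.
have [c cP] := fin_all_exists exc; apply/existsP; exists (finfun c).
by apply/(@li_coloring_irregular _ _ col) => [x y e xy ve|i]; rewrite ?ffunE //; apply: cP.
Qed.

End Graph.

Unset Implicit Arguments.

Theorem theorem4 (G : sgraph) (Gbip : bipartite G) (Gdec : decomposable G) :
  chi_irr Gdec <= 7 /\ (~~ odd #|edges G| -> chi_irr Gdec <= 6).
Proof.
(* Six colours suffice for either parity of the number of edges, which gives both claims. *)
suff le6 : chi_irr Gdec <= 6 by split=> //; apply: leq_trans le6 _.
rewrite /chi_irr; case: ex_minnP => m mcol; apply.
have [A bipA] := Gbip; apply/(li_colorable_dec bipA).
by apply: li_dec6; apply/(li_colorable_dec bipA); apply: mcol.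
Qed.
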